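(* Let $A$ denote the adjacency matrix of a simple graph $G$. Then $A$ is a Euclidean distance matrix (EDM) if and only if $G$ is a complete multipartite graph.
   Context: An $n\times n$ matrix $D=(d_{ij})$ is an EDM if there exist points $p^1,\ldots,p^n$ (not necessarily distinct) in some Euclidean space such that $d_{ij}=\|p^i-p^j\|^2$ for all $i,j=1,\ldots,n$. A cluster graph is a disjoint union of complete graphs (an isolated node $K_1$ counts as complete). A complete multipartite graph is the complement of a cluster graph; equivalently, its nodes can be partitioned into independent sets such that any two nodes in different sets are adjacent. In particular the complete graph $K_n$ and the null graph $\overline{K_n}$ are both complete multipartite. *)

(* Defs.v *)
From HB Require Import structures.
From mathcomp Require Import all_boot all_order all_algebra.
From mathcomp Require Import reals.

Set Implicit Arguments.
Unset Strict Implicit.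
Unset Printing Implicit Defensive.

Import Order.TTheory GRing.Theory Num.Theory.
Local Open Scope ring_scope.

Record sgraph (T : finType) := SGraph {
  adj : rel T;
  adj_sym : symmetric adj;
  adj_irr : irreflexive adj
}.

Definition compl_adj (T : finType) (G : sgraph T) : rel T :=
  fun x y => (x != y) && ~~ adj G x y.

Lemma compl_adj_sym (T : finType) (G : sgraph T) : symmetric (compl_adj G).
Proof. by move=> x y; rewrite /compl_adj eq_sym adj_sym. Qed.

Lemma compl_adj_irr (T : finType) (G : sgraph T) : irreflexive (compl_adj G).
Proof. by move=> x; rewrite /compl_adj eqxx. Qed.

Definition compl_graph (T : finType) (G : sgraph T) : sgraph T :=
  SGraph (@compl_adj_sym T G) (@compl_adj_irr T G).

(* A disjoint union of complete graphs: the blocks of P are the node sets of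
   the complete graphs, and no edge joins two of them. *)
Definition cluster_graph (T : finType) (G : sgraph T) : Prop :=
  exists P : {set {set T}},
    [/\ partition P [set: T],
        forall B, B \in P -> {in B &, forall x y, x != y -> adj G x y} &
        forall B C, B \in P -> C \in P -> B != C ->
          forall x y, x \in B -> y \in C -> ~~ adj G x y].

Definition complete_multipartite (T : finType) (G : sgraph T) : Prop :=
  cluster_graph (compl_graph G).

Definition adjmx (R : realType) (n : nat) (G : sgraph 'I_n) : 'M[R]_n :=
  \matrix_(i, j) (adj G i j)%:R.

(* The norm that MathComp-Analysis puts on 'rV[R]_k is the sup norm, hence this
   definition. *)
Definition enorm (R : realType) (k : nat) (v : 'rV[R]_k) : R :=
  Num.sqrt (\sum_(l < k) v 0 l ^+ 2).

Definition is_EDM (R : realType) (n : nat) (D : 'M[R]_n) : Prop :=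
  exists (k : nat) (p : 'I_n -> 'rV[R]_k),
    forall i j, D i j = enorm (p i - p j) ^+ 2.

(* Main.v *)
Require Import Defs.
From mathcomp Require Import all_boot all_order all_algebra.
From mathcomp Require Import reals.

(** A graph is complete multipartite exactly when some labelling [f] of its
    nodes makes adjacency coincide with having distinct labels: the parts are
    the fibres of [f].

    If the adjacency matrix is the matrix of squared distances of points [p i],
    then [p] is such a labelling, since an entry vanishes exactly when the two
    points coincide ([enorm_sqr_eq0], [labelling_complete_multipartite]).
    Conversely, labels distinguishing the parts
    ([complete_multipartite_pblock]) become points of a Euclidean space with one
    coordinate per label: the node [i] is sent to the basis vector of its label,
    divided by [sqrt 2], and distinct vertices of this regular simplex are at
    distance 1 ([enorm_sqr_delta]). *)

Set Implicit Arguments.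
Unset Strict Implicit.
Unset Printing Implicit Defensive.

Import Order.TTheory GRing.Theory Num.Theory.
Local Open Scope ring_scope.

Lemma enorm_sqrE (R : realType) (k : nat) (v : 'rV[R]_k) :
  enorm v ^+ 2 = \sum_(l < k) v 0 l ^+ 2.
Proof. by rewrite sqr_sqrtr // sumr_ge0 // => l _; rewrite sqr_ge0. Qed.

Lemma enorm_sqr_eq0 (R : realType) (k : nat) (v : 'rV[R]_k) :
  (enorm v ^+ 2 == 0) = (v == 0).
Proof.
rewrite enorm_sqrE psumr_eq0 => [|l _]; last exact: sqr_ge0.
apply/allP/eqP => [v0|-> l _]; last by rewrite mxE expr0n eqxx.
apply/rowP => l; rewrite mxE.
by apply/eqP; rewrite -sqrf_eq0; apply: v0; rewrite mem_index_enum.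
Qed.

Lemma enorm_sqr_delta (R : realType) (k : nat) (c : R) (a b : 'I_k) :
  enorm (c *: delta_mx 0 a - c *: delta_mx 0 b) ^+ 2
    = (a != b)%:R * (c ^+ 2 *+ 2).
Proof.
have [<-|neq_ab] := eqVneq a b.
  by rewrite subrr mul0r; apply/eqP; rewrite enorm_sqr_eq0.
rewrite enorm_sqrE (bigD1 a) // (bigD1 b) 1?eq_sym //= big1 => [|l].
  rewrite !mxE !eqxx (eq_sym b a) (negPf neq_ab) /=.
  by rewrite !mulr1 !mulr0 subr0 sub0r sqrrN addr0 mul1r mulr2n.
case/andP=> /negPf la /negPf lb.
by rewrite !mxE la lb /= mulr0 subr0 expr0n.
Qed.

(** The fibres of [f] are the parts; within the complement of [G] they are the
    cliques of a cluster graph because equality of labels is transitive. *)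
Lemma labelling_complete_multipartite (T : finType) (G : sgraph T)
    (S : eqType) (f : T -> S) :
  (forall x y, adj G x y = (f x != f y)) -> complete_multipartite G.
Proof.
move=> adjE; exists (preim_partition f [set: T]).
have eqv : {in [set: T] & &, equivalence_rel [rel x y | f x == f y]}.
  by split=> //= /eqP->.
have partP := preim_partitionP f [set: T].
have [/eqP covP tiP _] := and3P partP.
have blockE B x y : B \in preim_partition f [set: T] -> x \in B ->
    (y \in B) = (f x == f y).
  move=> PB Bx; rewrite -(def_pblock tiP PB Bx).
  exact: (pblock_equivalence_partition eqv).
split=> // [B PB x y Bx By neq_xy|B C PB PC neq_BC x y Bx Cy] /=.
  by rewrite /compl_adj neq_xy adjE -(blockE B) // By.
rewrite /compl_adj adjE -(blockE B) // negb_and !negbK.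
apply/orP; right; apply: contra neq_BC => By.
by rewrite -(def_pblock tiP PB By) (def_pblock tiP PC Cy).
Qed.

(** The part containing a node serves as its label, which makes the set of
    labels finite, as needed to index the coordinates of the embedding. *)
Lemma complete_multipartite_pblock (T : finType) (G : sgraph T) :
  complete_multipartite G ->
  exists P : {set {set T}}, forall x y, adj G x y = (pblock P x != pblock P y).
Proof.
case=> P [/and3P[/eqP covP tiP _] cliq sep]; exists P => x y.
have inP z : z \in cover P by rewrite covP inE.
have Px := pblock_mem (inP x); have Py := pblock_mem (inP y).
have xB : x \in pblock P x by rewrite mem_pblock.
have yB : y \in pblock P y by rewrite mem_pblock.
have [->|neq_xy] := eqVneq x y; first by rewrite adj_irr eqxx.
have [eqB|neqB] := eqVneq (pblock P x) (pblock P y).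
  rewrite -eqB in yB; have := cliq _ Px x y xB yB neq_xy.
  by rewrite /= /compl_adj => /andP[_ /negPf].
have := sep _ _ Px Py neqB x y xB yB.
by rewrite /= /compl_adj neq_xy negbK.
Qed.

Theorem theorem3p1 (R : realType) (n : nat) (G : sgraph 'I_n) :
  is_EDM (adjmx R G) <-> complete_multipartite G.
Proof.
split=> [[k [p distE]]|/complete_multipartite_pblock[P adjE]].
  apply: (labelling_complete_multipartite (f := p)) => i j.
  by rewrite -subr_eq0 -enorm_sqr_eq0 -distE mxE pnatr_eq0 eqb0 negbK.
(* One coordinate for every subset of the nodes, since every part is one. *)
exists #|{set 'I_n}|.
exists (fun i => Num.sqrt 2^-1 *: delta_mx 0 (enum_rank (pblock P i))).
move=> i j; rewrite mxE adjE enorm_sqr_delta (inj_eq enum_rank_inj).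
rewrite sqr_sqrtr ?invr_ge0 ?ler0n //.
by rewrite -[2^-1 *+ 2]mulr_natl mulfV ?pnatr_eq0 // mulr1.
Qed.
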